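(* Let $(\bar{A},\bar{B})$ be a structural pair, where $\bar{A}\in\{0,\star\}^{n\times n}$ is symmetrically structured and $\bar{B}\in\{0,\star\}^{n\times m}$ is a structured matrix, and let $\mathcal{X}=\{x_1,\dots,x_n\}$ be the set of state vertices of the system digraph $\mathcal{D}(\bar{A},\bar{B})$. Then $(\bar{A},\bar{B})$ is structurally controllable if and only if the following two conditions hold simultaneously in $\mathcal{D}(\bar{A},\bar{B})$: 1) all the state vertices are input-reachable; 2) $|\mathcal{N}(\mathcal{S})|\ge|\mathcal{S}|$ for all $\mathcal{S}\subseteq\mathcal{X}$.
   Context: A structured matrix $\bar{M}\in\{0,\star\}^{n\times m}$ is a matrix each of whose entries is either a fixed zero or an independent free (real) parameter, denoted $\star$. A matrix $\bar{A}\in\{0,\star\}^{n\times n}$ is symmetrically structured if, for all $i,j$, $[\bar{A}]_{ij}=\star$ if and only if $[\bar{A}]_{ji}=\star$, and the free parameter at $(i,j)$ is constrained to take the same value as the one at $(j,i)$ (otherwise the parameters are independent). A numerical realization of a (symmetrically) structured matrix is obtained by assigning real numbers to its independent free parameters (so realizations $\tilde{A}$ of $\bar{A}$ are real symmetric matrices). A numerical realization $(\tilde{A},\tilde{B})$ of the pair $(\bar A,\bar B)$ consists of numerical realizations of $\bar{A}$ and $\bar{B}$, the parameters of $\bar A$ and $\bar B$ being independent of each other. The pair $(\bar{A},\bar{B})$ is structurally controllable if there exists a numerical realization $(\tilde{A},\tilde{B})$ such that $Q(\tilde{A},\tilde{B}):=[\tilde{B},\tilde{A}\tilde{B},\dots,\tilde{A}^{n-1}\tilde{B}]$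 has full row rank. The system digraph $\mathcal{D}(\bar{A},\bar{B})$ has vertex set $\mathcal{X}\cup\mathcal{U}$, with state vertices $\mathcal{X}=\{x_1,\dots,x_n\}$ and input vertices $\mathcal{U}=\{u_1,\dots,u_m\}$, and directed edges $(x_j,x_i)$ whenever $[\bar{A}]_{ij}=\star$ and $(u_j,x_i)$ whenever $[\bar{B}]_{ij}=\star$. For a set $\mathcal{S}$ of vertices, $\mathcal{N}(\mathcal{S})$ is the in-neighbour set: the set of all vertices $v\in\mathcal{X}\cup\mathcal{U}$ such that $(v,w)$ is an edge for some $w\in\mathcal{S}$. A state vertex is input-reachable if there is a directed path to it from some input vertex. *)

(* Defs.v *)
(* Built on Mathematical Components; the reals are an arbitrary [R : realType]. *)
From mathcomp Require Import all_boot all_order all_algebra.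
From mathcomp Require Import reals.

Set Implicit Arguments.
Unset Strict Implicit.
Unset Printing Implicit Defensive.

Import GRing.Theory.
Local Open Scope ring_scope.

(* An entry [true] is a free parameter (star), an entry [false] a fixed zero. *)
Definition structured (n m : nat) : Type := 'M[bool]_(n, m).

Definition symmetrically_structured n (A : structured n n) : Prop :=
  forall i j, A i j = A j i.

Definition realization (R : realType) n m
    (M : structured n m) (Mt : 'M[R]_(n, m)) : Prop :=
  forall i j, M i j = false -> Mt i j = 0.

(* The parameters at (i, j) and (j, i) are one and the same. *)
Definition symmetric_realization (R : realType) n
    (A : structured n n) (At : 'M[R]_n) : Prop :=
  realization A At /\ forall i j, At i j = At j i.

(* [B, A B, ..., A^(n-1) B], with n blocks of m columns each. *)
Definition controllability_matrix (R : realType) n m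
    (A : 'M[R]_n) (B : 'M[R]_(n, m)) : 'M[R]_(n, \sum_(k < n) m) :=
  \mxrow_(k < n) (A ^+ k *m B).

Definition structurally_controllable (R : realType) n m
    (A : structured n n) (B : structured n m) : Prop :=
  exists (At : 'M[R]_n) (Bt : 'M[R]_(n, m)),
    [/\ symmetric_realization A At, realization B Bt
      & \rank (controllability_matrix At Bt) = n].

(* [inl i] is the state vertex x_i and [inr j] the input vertex u_j. *)
Definition vertex (n m : nat) : finType := ('I_n + 'I_m)%type.

(* [system_edge A B v w] : there is an edge from v to w. Note the transposition:
   the entry (i, j) gives an edge into x_i. *)
Definition system_edge n m (A : structured n n) (B : structured n m) :
    rel (vertex n m) :=
  fun v w => match v, w with
  | inl j, inl i => A i j
  | inr j, inl i => B i j
  | _, inr _ => false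
  end.

Definition state_vertices n m : {set vertex n m} :=
  [set (inl i : vertex n m) | i : 'I_n].

Definition input_vertices n m : {set vertex n m} :=
  [set (inr j : vertex n m) | j : 'I_m].

Definition in_neighbours n m (A : structured n n) (B : structured n m)
    (S : {set vertex n m}) : {set vertex n m} :=
  [set v | [exists w in S, system_edge A B v w]].

Definition input_reachable n m (A : structured n n) (B : structured n m)
    (x : vertex n m) : Prop :=
  exists2 u, u \in input_vertices n m & connect (system_edge A B) u x.

(* Main.v *)
Require Import Defs.
From mathcomp Require Import all_boot all_order all_algebra.
From mathcomp Require Import reals.
From mathcomp Require Import perm boolp complex ring zify.

(* Necessity: if no input reaches x_i, then row i of the controllability matrix
   vanishes; and since that matrix has full row rank, so does [A, B], hence the
   rows of [A, B] indexed by S, which vanish outside the columns N(S), are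
   independent.

   Sufficiency: Hall's theorem turns condition 2 into an injection f sending every
   state to an in-neighbour. Its orbits are paths issued from inputs, whose
   symmetric (tridiagonal) realization is controllable, and cycles. On a cycle with
   a marked vertex j there is an invertible symmetric realization C that is
   observable from j. By condition 1 the cycles can be attached one at a time, each
   through one edge between j and an input or a state i already present. The
   matrix c C + e (E_ij + E_ji) then preserves controllability for suitable scalars:
   c keeps the eigenvalues of c C, all nonzero, away from the finitely many zeros of
   the transfer function from the inputs to x_i, and e avoids one value for each
   such zero. The Hautus test is run over an algebraically closed extension of the
   reals; all the entries chosen are natural numbers. *)

Set Implicit Arguments.
Unset Strict Implicit.
Unset Printing Implicit Defensive.
Import Order.TTheory GRing.Theory Num.Theory.
Local Open Scope ring_scope.

(** * Products of linear factors of a matrix acting on a row vector *)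

Section LinearFactors.
Variables (F : fieldType) (n : nat) (A : 'M[F]_n).
Implicit Types (v e : 'rV[F]_n) (s : seq F).

Definition mul_factors v s : 'rV[F]_n := foldr (fun a w => w *m (A - a%:M)) v s.

Lemma mul_factors_shift v s l :
  mul_factors (v *m (A - l%:M)) s = mul_factors v s *m (A - l%:M).
Proof.
elim: s => [//|a s /= ->]; rewrite -!mulmxA; congr (_ *m _).
by rewrite !mulmxBl !mulmxBr !mul_scalar_mx !mul_mx_scalar !scale_scalar_mx
  [l * a]mulrC !opprD !opprK !addrA [X in X + _]addrAC.
Qed.

Lemma mul_factorsN v s : mul_factors (- v) s = - mul_factors v s.
Proof. by elim: s => [//|a s /= ->]; rewrite mulNmx. Qed.

(** The hypothesis states [z = e (l - A)^-1] without inverting [l - A]. Iterating the identity gives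
    [mul_factors z s] as a multiple of [z] plus images of [e] with coefficients polynomial in
    [l]. *)
Lemma mul_factors_resolvent z e l a s :
  z *m A = l *: z - e ->
  mul_factors z (a :: s) = (l - a) *: mul_factors z s - mul_factors e s.
Proof.
move=> zA; have ze : z *m (A - l%:M) = - e.
  by rewrite mulmxBr zA mul_mx_scalar addrAC subrr add0r.
have zsA : mul_factors z s *m A = l *: mul_factors z s - mul_factors e s.
  rewrite -[LHS](subrK (l *: mul_factors z s)) -mul_mx_scalar -mulmxBr.
  by rewrite -mul_factors_shift ze mul_factorsN mul_mx_scalar addrC.
by rewrite /= mulmxBr mul_mx_scalar zsA scalerBl addrAC.
Qed.

(** Each factor uses up one power of [A]. *)
Lemma mul_factors_krylov m (B : 'M[F]_(n, m)) N v s k :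
  (forall k, (k < N)%N -> v *m (A ^+ k *m B) = 0) ->
  (k + size s < N)%N -> mul_factors v s *m (A ^+ k *m B) = 0.
Proof.
move=> hv; elim: s k => [|a s IH] k /=; first by rewrite addn0; exact: hv.
rewrite addnS => lt_k.
rewrite -mulmxA mulmxBl mulmxBr [A *m _]mulmxA.
rewrite -[A *m A ^+ k]/(A * A ^+ k) -exprS IH //.
by rewrite mul_scalar_mx -scalemxAr IH ?scaler0 ?subrr // ltnW.
Qed.

End LinearFactors.

(** Cayley-Hamilton for the split characteristic polynomial. *)
Lemma char_factors (F : closedFieldType) n (A : 'M[F]_n) :
  exists2 s : seq F, size s = n & forall v, mul_factors A v s = 0.
Proof.
case: n A => [|n] A; first by exists [::] => // v; rewrite thinmx0.
have [s ps] := closed_field_poly_normal (char_poly A).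
move: ps; rewrite (monicP (char_poly_monic A)) scale1r => ps.
exists s => [|v].
  by have := size_char_poly A; rewrite ps size_prod_XsubC => -[].
suff mul_s w : mul_factors A w s = w *m horner_mx A (\prod_(z <- s) ('X - z%:P)).
  by rewrite mul_s -ps Cayley_Hamilton mulmx0.
elim: {ps}s w => [|a s IH] w /=; first by rewrite big_nil rmorph1 mulmx1.
rewrite IH big_cons mulrC rmorphM rmorphB /= horner_mx_X horner_mx_C.
by rewrite -mulmxA.
Qed.

Lemma closed_field_roots (F : closedFieldType) (p : {poly F}) :
  p != 0 -> exists s : seq F, forall x, root p x -> x \in s.
Proof.
move=> p0; have [s ps] := closed_field_poly_normal p; exists s => x.
by rewrite ps rootZ ?lead_coef_eq0 // root_prod_XsubC.
Qed.

(** * Projections onto sets of coordinates *)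

Section CoordinateProjection.
Variables (F : fieldType) (n : nat).
Implicit Types (S P : {set 'I_n}) (A : 'M[F]_n) (v : 'rV[F]_n).

(** Subsystems remain [n] by [n] matrices cut out by such projections, so that nothing is reindexed
    when [S] grows. *)
Definition coord_proj S : 'M[F]_n := diag_mx (\row_k (k \in S)%:R).

Lemma mul_coord_proj m S (M : 'M[F]_(m, n)) i k :
  (M *m coord_proj S) i k = if k \in S then M i k else 0.
Proof.
rewrite /coord_proj mul_mx_diag !mxE.
by case: (k \in S); rewrite ?mulr1 ?mulr0.
Qed.

Lemma coord_proj_mul m S (M : 'M[F]_(n, m)) i k :
  (coord_proj S *m M) i k = if i \in S then M i k else 0.
Proof.
rewrite /coord_proj mul_diag_mx !mxE.
by case: (i \in S); rewrite ?mul1r ?mul0r.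
Qed.

Lemma coord_projT : coord_proj setT = 1%:M.
Proof.
apply/matrixP => i j; rewrite -[coord_proj _]mul1mx mul_coord_proj.
by rewrite in_setT.
Qed.

Lemma coord_proj_disjoint S P : [disjoint S & P] ->
  coord_proj S *m coord_proj P = 0.
Proof.
move=> dSP; apply/matrixP => i j; rewrite mul_coord_proj !mxE.
case: eqP => [->|_]; last by case: ifP; rewrite ?mulr0n.
by case: ifP => // jP; rewrite (disjointFl dSP jP).
Qed.

Lemma coord_projU S P : [disjoint S & P] ->
  coord_proj (S :|: P) = coord_proj S + coord_proj P.
Proof.
move=> dSP; apply/matrixP => i j; rewrite !mxE in_setU -mulrnDl -natrD.
by case: (boolP (i \in S)) => //= iS; rewrite (disjointFr dSP iS) addn0.
Qed.

Lemma coord_proj_delta S i : i \in S ->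
  (delta_mx 0 i : 'rV[F]_n) *m coord_proj S = delta_mx 0 i.
Proof.
move=> iS; apply/rowP => k; rewrite mul_coord_proj !mxE /=.
by case: eqP => [->|_]; rewrite ?iS // if_same.
Qed.

Lemma coord_proj_delta0 S i : i \notin S ->
  (delta_mx 0 i : 'rV[F]_n) *m coord_proj S = 0.
Proof.
move=> iS; apply/rowP => k; rewrite mul_coord_proj !mxE /=.
by case: eqP => [->|_]; rewrite ?(negPf iS) // if_same.
Qed.

Lemma mul_row_delta m v i (j : 'I_m) :
  v *m delta_mx i j = v 0 i *: delta_mx 0 j.
Proof.
apply/rowP => k; rewrite !mxE (bigD1 i) //= big1 ?addr0 => [|l li].
  by rewrite !mxE !eqxx.
by rewrite !mxE (negPf li) mulr0.
Qed.

(** The upper bound comes from a sum of rank-one matrices. Applied to [S] and to its complement it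
    forces equality, as the two projections add up to the identity. *)
Lemma rank_coord_proj S : \rank (coord_proj S) = #|S|.
Proof.
have rank_le T : (\rank (coord_proj T) <= #|T|)%N.
  have -> : coord_proj T = \sum_(i in T) delta_mx i i.
    apply/matrixP => r s; rewrite summxE mxE mxE.
    have [rT|rT] := boolP (r \in T).
      rewrite (bigD1 r) //= big1 => [|i /andP[_ /negPf ir]].
        by rewrite mxE eqxx addr0 eq_sym.
      by rewrite mxE eq_sym ir.
    rewrite big1 ?mul0rn // => i iT; rewrite mxE; case: eqP => // ri.
    by rewrite ri iT in rT.
  rewrite -sum1_card; apply: (big_ind2 (fun (M : 'M[F]_n) k => \rank M <= k)%N).
  - by rewrite mxrank0.
  - move=> M k M' k' Mk M'k'; exact: leq_trans (mxrank_add _ _) (leq_add _ _).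
  - by move=> i _; rewrite mxrank_delta.
apply/eqP; rewrite eqn_leq rank_le /= -(leq_add2r #|~: S|) cardsC card_ord.
apply: leq_trans (_ : (\rank (coord_proj S) + \rank (coord_proj (~: S)) <= _)%N).
  rewrite -[leqLHS](mxrank1 F) -coord_projT -(setUCr S) coord_projU.
    exact: mxrank_add.
  by rewrite -setI_eq0 setICr.
by rewrite leq_add2l.
Qed.

Definition supported S A := coord_proj S *m A = A /\ A *m coord_proj S = A.

End CoordinateProjection.

Arguments coord_proj {F n}.
Arguments coord_proj_disjoint {F n S P}.
Arguments coord_projU {F n S P}.
Arguments coord_proj_delta {F n S i}.
Arguments coord_proj_delta0 {F n S i}.

(** * The Hautus test and its consequences *)

Section Hautus.
Variables (F : numClosedFieldType) (n : nat).
Implicit Types (S P : {set 'I_n}) (A C : 'M[F]_n) (v : 'rV[F]_n).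

(* The Popov-Belevitch-Hautus test for the subsystem carried by [S]. *)
Definition hautus m S A (B : 'M[F]_(n, m)) :=
  forall l v, v *m coord_proj S = v -> v *m A = l *: v -> v *m B = 0 -> v = 0.

Lemma mul_factors_supported S A v s : A *m coord_proj S = A ->
  v *m coord_proj S = v -> mul_factors A v s *m coord_proj S = mul_factors A v s.
Proof.
move=> AS vS; elim: s => [//|a s IH] /=.
by rewrite mulmxBr mulmxBl -!mulmxA AS mul_scalar_mx mul_mx_scalar -scalemxAr IH.
Qed.

(** The factors of the annihilating product are stripped off one by one: what remains before the
    factor [A - a] satisfies the eigenvector equation for [a] and is killed by [B], hence is 0. *)
Lemma hautus_krylov m S A (B : 'M[F]_(n, m)) v :
  A *m coord_proj S = A -> hautus S A B -> v *m coord_proj S = v ->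
  (forall k, (k < n)%N -> v *m (A ^+ k *m B) = 0) -> v = 0.
Proof.
move=> AS hAB vS hv; have [s sz_s /(_ v)] := char_factors A.
have : (size s <= n)%N by rewrite sz_s.
elim: {sz_s}s => [//|a s IH] /= lt_s sv0.
apply: IH; first exact: ltnW.
apply: (hAB a); first exact: mul_factors_supported.
  by apply/eqP; rewrite -subr_eq0 -mul_mx_scalar -mulmxBr sv0.
by rewrite -[B]mul1mx; apply: (@mul_factors_krylov _ _ _ _ _ n _ _ 0).
Qed.

(* The transfer function from the inputs to coordinate [i] of a controllable
   system vanishes at finitely many points only. *)
Lemma hautus_transfer_zeros m S A (B : 'M[F]_(n, m)) (e : 'rV[F]_n) :
  A *m coord_proj S = A -> hautus S A B -> e *m coord_proj S = e -> e != 0 ->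
  exists2 p : {poly F}, p != 0 &
    forall l z, z *m A = l *: z - e -> z *m B = 0 -> root p l.
Proof.
move=> AS hAB eS e0; have [s _ s0] := char_factors A.
(* [(r u t).1] evaluates at [l] to the coordinate [u] of [mul_factors A z t *m B]. *)
pose r u := foldr (fun a (q : {poly F} * seq F) =>
  (('X - a%:P) * q.1 - ((mul_factors A e q.2 *m B) 0 u)%:P, a :: q.2)) (0, [::]).
have r2 u t : (r u t).2 = t by elim: t => [//|a t /= ->].
have rE u a t : (r u (a :: t)).1 =
    ('X - a%:P) * (r u t).1 - ((mul_factors A e t *m B) 0 u)%:P by rewrite /= r2.
(* Where a factor first turns a nonzero partial product of [e] into 0, that product is a left
   eigenvector, so [hAB] yields a nonzero coordinate [u] of its image under [B]; [r_step] carries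
   this through the remaining factors. *)
have [u ru] : exists u, (r u s).1 != 0.
  move: (s0 e); elim: {s0}s => [/eqP|a s IH s0]; first by rewrite (negPf e0).
  (* A nonzero polynomial times ['X - a%:P] has degree at least 1, so subtracting a constant cannot
     cancel it. *)
  have r_step u : ((r u s).1 != 0) || ((mul_factors A e s *m B) 0 u != 0) ->
      (r u (a :: s)).1 != 0.
    rewrite rE; have [->|r0 _] := eqVneq (r u s).1 0.
      by rewrite mulr0 sub0r oppr_eq0 polyC_eq0.
    rewrite subr_eq0; apply/eqP => /(congr1 (fun q : {poly F} => size q)).
    rewrite mulrC size_Mmonic ?monicXsubC // size_XsubC addn2 size_polyC /=.
    by move: r0; rewrite -size_poly_eq0; case: size => // k _; case: (_ != 0).
  have [/IH[u ru]|es0] := eqVneq (mul_factors A e s) 0.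
    by exists u; apply: r_step; rewrite ru.
  have /rV0Pn[u esB] : mul_factors A e s *m B != 0.
    apply: contra_neq es0 => esB; apply: (hAB a) => //.
      exact: mul_factors_supported.
    by apply/eqP; rewrite -subr_eq0 -mul_mx_scalar -mulmxBr; apply/eqP.
  by exists u; apply: r_step; rewrite esB orbT.
exists (r u s).1 => // l z zA zB.
have -> : root (r u s).1 l = ((mul_factors A z s *m B) 0 u == 0).
  rewrite /root; congr (_ == _).
  elim: {s0 ru}s => [|a s IH]; first by rewrite /= horner0 zB mxE.
  rewrite rE !hornerE IH (mul_factors_resolvent _ _ zA) mulmxBl -scalemxAl !mxE.
  by [].
by rewrite s0 mul0mx mxE.
Qed.
Lemma natr_notin (s : seq F) : exists k, k.+1%:R \notin s.
Proof.
apply: contrapT => /forallNP sP.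
pose t := [seq k.+1%:R : F | k <- iota 0 (size s).+1].
have t_uniq : uniq t.
  by rewrite map_inj_uniq ?iota_uniq // => i j /eqP; rewrite eqr_nat => /eqP[].
have /(uniq_leq_size t_uniq) : {subset t <= s}.
  by move=> _ /mapP[k _ ->]; apply: contrapT => /negP; exact: sP.
by rewrite size_map size_iota ltnn.
Qed.

(** Only the finitely many quotients of a root of [p] by a root of [q] must be avoided. *)
Lemma scaled_roots_avoid (p q : {poly F}) : p != 0 -> q != 0 ->
  exists c, forall l, l != 0 -> root q l -> ~~ root p (c.+1%:R * l).
Proof.
move=> /closed_field_roots[s sP] /closed_field_roots[t tP].
have [c cP] := natr_notin [seq x / y | x <- s, y <- t].
exists c => l l0 /tP lt; apply: contra cP => /sP cls.
by rewrite -[X in X \in _](mulfK l0); apply: allpairs_f.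
Qed.

Lemma natr_avoid_bad (s : seq F) (bad : F -> nat -> Prop) :
  (forall l k1 k2, l \in s -> bad l k1 -> bad l k2 -> k1 = k2) ->
  exists k, forall l, l \in s -> ~ bad l k.
Proof.
move=> bad_uniq.
have [t tP] : exists t : seq nat, forall l k, l \in s -> bad l k -> k \in t.
  elim: s bad_uniq => [|a s IH] bad_uniq; first by exists [::].
  have [|t tP] := IH.
    by move=> l k1 k2 ls; apply: bad_uniq; rewrite inE ls orbT.
  have [[k0 k0P]|noP] := EM (exists k, bad a k); last first.
    exists t => l k; rewrite inE => /predU1P[-> bk|]; last exact: tP.
    by case: noP; exists k.
  exists (k0 :: t) => l k; rewrite !inE => /predU1P[-> bk|ls bk].
    by rewrite (bad_uniq a k k0) ?eqxx // mem_head.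
  by rewrite (tP l) ?orbT.
have [k kP] : exists k, k \notin t.
  exists (\max_(k <- t) k).+1; apply/negP => kt.
  by have := @leq_bigmax_seq _ t xpredT id _ kt isT; rewrite ltnn.
by exists k => l ls /(tP _ _ ls); apply/negP.
Qed.

(** * Attaching a block [C] on [P] to a controllable system on [S] *)

Section Attach.
Variables (m : nat) (S P : {set 'I_n}) (A C : 'M[F]_n) (B : 'M[F]_(n, m)).
Variable j : 'I_n.
Hypothesis dSP : [disjoint S & P].
Hypothesis jP : j \in P.
Hypothesis suppA : supported S A.
Hypothesis suppB : coord_proj S *m B = B.
Hypothesis hautusA : hautus S A B.
Hypothesis suppC : supported P C.
Hypothesis C_inj : forall v, v *m coord_proj P = v -> v *m C = 0 -> v = 0.
Hypothesis C_obs :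
  forall l v, v *m coord_proj P = v -> v *m C = l *: v -> v 0 j = 0 -> v = 0.

Let projK (T : {set 'I_n}) v :
  v *m coord_proj T *m coord_proj T = v *m coord_proj T.
Proof. by apply/rowP => k; rewrite !mul_coord_proj; case: (k \in T). Qed.

Let AP : A *m coord_proj P = 0.
Proof. by rewrite -suppA.2 -mulmxA coord_proj_disjoint ?mulmx0. Qed.

Let CS : C *m coord_proj S = 0.
Proof.
by rewrite -suppC.2 -mulmxA coord_proj_disjoint ?mulmx0 // disjoint_sym.
Qed.

Let eigenvalueC l v : v *m coord_proj P = v -> v != 0 -> v *m C = l *: v ->
  l != 0 /\ root (char_poly C) l.
Proof.
move=> vP v0 vC; split.
  by apply: contra_neq v0 => l0; apply: C_inj => //; rewrite vC l0 scale0r.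
by rewrite -eigenvalue_root_char; apply/eigenvalueP; exists v.
Qed.

(** An eigenvector splits into parts [x] on [S] and [y] on [P] with the same eigenvalue. Scaling
    moves the eigenvalues of [C] on [P], nonzero by [C_inj], off those of [A]. So [y != 0] forces
    [x = 0]; the new entry of the input matrix then gives [y 0 j = 0], against [C_obs]. *)
Lemma hautus_attach_input (u : 'I_m) : exists c : nat,
  hautus (S :|: P) (A + c.+1%:R *: C) (B + delta_mx j u).
Proof.
have [c cP] := scaled_roots_avoid (monic_neq0 (char_poly_monic A))
  (monic_neq0 (char_poly_monic C)).
exists c => l v vSP vA vB.
have c0 : c.+1%:R != 0 :> F by rewrite pnatr_eq0.
pose x := v *m coord_proj S; pose y := v *m coord_proj P.
have vxy : v = x + y by rewrite -mulmxDr -coord_projU.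
have xA : x *m A = l *: x.
  rewrite scalemxAl -vA mulmxDr mulmxDl -scalemxAr -scalemxAl -!mulmxA CS.
  by rewrite !mulmx0 scaler0 addr0 suppA.2 suppA.1.
have yC : c.+1%:R *: (y *m C) = l *: y.
  rewrite [RHS]scalemxAl -vA mulmxDr mulmxDl -scalemxAr -scalemxAl -!mulmxA AP.
  by rewrite !mulmx0 add0r suppC.2 suppC.1.
have vj : v 0 j = y 0 j by rewrite mul_coord_proj jP.
have xB : x *m B + y 0 j *: delta_mx 0 u = 0.
  by rewrite -[RHS]vB mulmxDr mul_row_delta vj -mulmxA suppB.
have yC' : y *m C = (l / c.+1%:R) *: y.
  by rewrite mulrC -scalerA -yC scalerA mulVf ?scale1r.
have [y0|y0] := eqVneq y 0.
  rewrite vxy y0 addr0; apply: (hautusA (l := l)) => //; first exact: projK.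
  by rewrite -[RHS]xB y0 mxE scale0r addr0.
have [l0 rl] := eigenvalueC (projK P v) y0 yC'.
have x0 : x = 0.
  apply: contraNeq (cP _ l0 rl) => x0.
  rewrite mulrC divfK // -eigenvalue_root_char; apply/eigenvalueP.
  by exists x.
have yj : y 0 j = 0.
  have /rowP/(_ u) := xB; rewrite x0 mul0mx add0r !mxE !eqxx mulr1.
  by [].
by case/eqP: y0; apply: (C_obs (l := l / c.+1%:R)) => //; apply: projK.
Qed.

Lemma hautus_attach_state i : i \in S -> exists c e : nat,
  hautus (S :|: P)
    (A + c.+1%:R *: C + e.+1%:R *: (delta_mx i j + delta_mx j i)) B.
Proof.
move=> iS.
have [p p0 pP] : exists2 p : {poly F}, p != 0 & forall l (z : 'rV[F]_n),
    z *m A = l *: z - delta_mx 0 i -> z *m B = 0 -> root p l.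
  have d0 : delta_mx 0 i != 0 :> 'rV[F]_n.
    by apply/rV0Pn; exists i; rewrite mxE !eqxx oner_eq0.
  exact: hautus_transfer_zeros suppA.2 hautusA (coord_proj_delta iS) d0.
have [c cP] := scaled_roots_avoid p0 (monic_neq0 (char_poly_monic C)).
have c0 : c.+1%:R != 0 :> F by rewrite pnatr_eq0.
have [s sP] := closed_field_roots p0.
(* A vector violating the test yields such a pair: [z] is its part on [S] divided by [e.+1 * y 0 j],
   and [y] its part on [P] divided by [y 0 j]. Both coupling entries contribute, hence the
   square. *)
pose bad l (e : nat) := root p l /\ exists z y : 'rV[F]_n,
  [/\ z *m coord_proj S = z, z *m A = l *: z - delta_mx 0 i & z *m B = 0] /\
  [/\ y *m coord_proj P = y,
    l *: y - c.+1%:R *: (y *m C) = (e.+1%:R ^+ 2 * z 0 i) *: delta_mx 0 j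
    & y 0 j = 1].
have [|e eP] := @natr_avoid_bad s bad.
  move=> l e1 e2 _ [rl [z [y [[zS zA zB] [yP yC yj]]]]].
  move=> [_ [z' [y' [[zS' zA' zB'] [yP' yC' yj']]]]].
  have zz : z' = z.
    apply/eqP; rewrite -subr_eq0; apply/eqP.
    apply: (hautusA (l := l)); rewrite mulmxBl ?zS ?zS' ?zB ?zB' ?subrr //.
    by rewrite zA zA' scalerBr opprB addrA addrNK.
  rewrite {}zz in yC'.
  apply: contrapT => e12.
  (* With the same [z] on both sides, this combination cancels the right-hand sides: [w] is an
     eigenvector of [c.+1 C] at a root of [p], which the choice of [c] excludes. Its coordinate [j]
     is a difference of distinct squares. *)
  pose w := e2.+1%:R ^+ 2 *: y - e1.+1%:R ^+ 2 *: y'.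
  have wP : w *m coord_proj P = w by rewrite mulmxBl -!scalemxAl yP yP'.
  have w0 : w != 0.
    apply/rV0Pn; exists j; rewrite !mxE yj yj' !mulr1 subr_eq0 -!natrX eqr_nat.
    by rewrite eqn_exp2r // eqSS; apply/eqP => /esym.
  have wC : w *m C = (l / c.+1%:R) *: w.
    apply: (scalerI c0); rewrite scalerA [_ * (l / _)]mulrC divfK //.
    rewrite mulmxBl -!scalemxAl; apply/rowP => k.
    have /rowP/(_ k) := yC; have /rowP/(_ k) := yC'; rewrite !mxE.
    move=> /eqP; rewrite subr_eq => /eqP ly' /eqP; rewrite subr_eq => /eqP ly.
    have -> : forall a a' b b', l * (a * b - a' * b') = a * (l * b) - a' * (l * b').
      by move=> *; ring.
    by rewrite ly ly'; ring.
  have [l0 /(cP _ l0)/negP] := eigenvalueC wP w0 wC; apply.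
  by rewrite mulrC divfK.
exists c, e => l v vSP vA vB.
have e0 : e.+1%:R != 0 :> F by rewrite pnatr_eq0.
pose x := v *m coord_proj S; pose y := v *m coord_proj P.
have vxy : v = x + y by rewrite -mulmxDr -coord_projU.
have vAx : v *m A = x *m A by rewrite -mulmxA suppA.1.
have vCy : v *m C = y *m C by rewrite -mulmxA suppC.1.
have vi : v 0 i = x 0 i by rewrite mul_coord_proj iS.
have vj : v 0 j = y 0 j by rewrite mul_coord_proj jP.
have {}vA : x *m A + c.+1%:R *: (y *m C)
    + e.+1%:R *: (x 0 i *: delta_mx 0 j + y 0 j *: delta_mx 0 i) = l *: v.
  by rewrite -vA !mulmxDr -!scalemxAr mulmxDr !mul_row_delta vAx vCy vi vj.
have iP : i \notin P by rewrite (disjointFr dSP iS).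
have jS : j \notin S by rewrite (disjointFl dSP jP).
have xA : x *m A + (e.+1%:R * y 0 j) *: delta_mx 0 i = l *: x.
  rewrite [RHS]scalemxAl -vA !mulmxDl -!scalemxAl mulmxDl -!scalemxAl -!mulmxA.
  rewrite CS suppA.2 (coord_proj_delta iS) (coord_proj_delta0 jS).
  by rewrite !mulmx0 !scaler0 addr0 add0r scalerA.
have yC : c.+1%:R *: (y *m C) + (e.+1%:R * x 0 i) *: delta_mx 0 j = l *: y.
  rewrite [RHS]scalemxAl -vA !mulmxDl -!scalemxAl mulmxDl -!scalemxAl -!mulmxA.
  rewrite AP suppC.2 (coord_proj_delta0 iP) (coord_proj_delta jP).
  by rewrite !mulmx0 scaler0 addr0 add0r scalerA.
have xB : x *m B = 0 by rewrite -[RHS]vB -mulmxA suppB.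
(* If [y 0 j = 0], nothing enters [S], so [x = 0], and then nothing enters [P]. Otherwise dividing
   by [y 0 j] produces a bad pair. *)
have [yj|yj] := eqVneq (y 0 j) 0.
  have x0 : x = 0.
    apply: (hautusA (l := l)) => //; first exact: projK.
    by rewrite -xA yj mulr0 scale0r addr0.
  rewrite vxy x0 add0r; apply: (C_obs (l := l / c.+1%:R)) => //.
    exact: projK.
  apply: (scalerI c0); rewrite scalerA mulrC divfK // -yC x0 mxE mulr0 scale0r.
  by rewrite addr0.
have zA : ((e.+1%:R * y 0 j)^-1 *: x) *m A =
    l *: ((e.+1%:R * y 0 j)^-1 *: x) - delta_mx 0 i.
  rewrite -scalemxAl scalerA [l * _]mulrC -scalerA -xA scalerDr scalerA mulVf.
    by rewrite scale1r addrK.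
  by rewrite mulf_neq0.
have zB : ((e.+1%:R * y 0 j)^-1 *: x) *m B = 0 by rewrite -scalemxAl xB scaler0.
have rl := pP _ _ zA zB.
case: (eP l (sP _ rl)); split=> //.
exists ((e.+1%:R * y 0 j)^-1 *: x), ((y 0 j)^-1 *: y); split; split=> //.
- by rewrite -scalemxAl projK.
- by rewrite -scalemxAl projK.
- rewrite -scalemxAl !scalerA ![_ * (y 0 j)^-1]mulrC -!scalerA -scalerBr -yC.
  rewrite addrC addrA addNr add0r !scalerA [(_ *: x) 0 i]mxE; congr (_ *: _).
  by field; rewrite yj nat1r.
- by rewrite [((y 0 j)^-1 *: y) 0 j]mxE mulVf.
Qed.
End Attach.

End Hautus.

(** * Eigenvectors of a weighted cycle of length [p], read as periodic sequences *)

Section CyclicRecurrence.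
Variables (F : numFieldType) (p : nat) (a w : nat -> F) (d l : F).
Hypothesis p_gt0 : (0 < p)%N.
Hypothesis a_period : forall k, a (p + k)%N = a k.
Hypothesis w_period : forall k, w (p + k)%N = w k.
Hypothesis w0 : w 0 = d.
Hypothesis w1 : forall k, (0 < k < p)%N -> w k = 1.
Hypothesis d_val : d = if odd p then 2 else 0.
Hypothesis aE : forall k, l * a k.+1 = a k * w k.+1 + a k.+2 * w k.+2.

Let a_p : a p = a 0.
Proof. by rewrite -[p in LHS]addn0 a_period. Qed.

Let w_p : w p = d.
Proof. by rewrite -[p]addn0 w_period. Qed.

Lemma cyclic_recurrence_obs : a 0 = 0 -> forall k, (k < p)%N -> a k = 0.
Proof.
move=> a0; have [p_gt1|p_le1] := ltnP 1 p; last first.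
  by move=> [//|k] /leq_trans/(_ p_le1).
have rec k : (k.+1 < p)%N -> a k.+2 = l * a k.+1 - a k.
  move=> kp; rewrite aE w1 // mulr1 addrAC subrr add0r.
  have [kp2|kp2] := ltnP k.+2 p; first by rewrite w1 ?mulr1.
  by have -> : k.+2 = p; [lia | rewrite a_p a0 mul0r].
(* Both [a] and its reversal solve the recurrence with initial value 0, hence
   they are proportional. *)
have rev k : (k.+1 <= p)%N -> a 1 * a (p - k)%N = a p.-1 * a k /\
    a 1 * a (p - k.+1)%N = a p.-1 * a k.+1.
  elim: k => [|k IH] kp.
    by rewrite subn0 a_p a0 !mulr0 subn1 mulrC.
  have [IH1 IH2] := IH (ltnW kp); split=> //.
  have -> : a (p - k.+2)%N = l * a (p - k.+1)%N - a (p - k)%N.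
    have [-> ->] : (p - k.+1 = (p - k.+2).+1)%N /\ (p - k = (p - k.+2).+2)%N.
      by lia.
    by rewrite rec ?opprB ?addrA ?addrK //; [ring | lia].
  by rewrite rec // !mulrBr ![_ * (l * _)]mulrCA IH1 IH2.
(* The recurrence at the marked vertex reads [a 1 = - (a p.-1 * d)], which settles [d = 0]. For
   [d = 2], proportionality gives [a 1 ^+ 2 = a p.-1 ^+ 2], so [3 (a p.-1)^2 = 0]. *)
have a1 : a 1 = 0.
  have [|/= + _] := rev p.-1; first by rewrite prednK.
  have -> : (p - p.-1 = 1)%N by lia.
  have : a 1 = - (a p.-1 * d).
    apply/eqP; rewrite -addr_eq0 addrC.
    have := aE p.-1; rewrite prednK // a_p a0 mulr0 w_p => ->.
    by rewrite -[p.+1]addn1 a_period w_period w1 // mulr1.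
  move=> ->; rewrite d_val; case: odd; last by rewrite mulr0 oppr0.
  move=> b2; have : a p.-1 ^+ 2 *+ 3 = 0.
    have -> : a p.-1 ^+ 2 *+ 3 =
       - (a p.-1 * 2) * - (a p.-1 * 2) - a p.-1 * a p.-1 by ring.
    by rewrite b2 subrr.
  by move/eqP; rewrite mulrn_eq0 expf_eq0 /= => /eqP ->; rewrite mul0r oppr0.
suff ak k : (k < p)%N -> a k = 0 /\ a k.+1 = 0 by move=> k /ak[].
elim: k => [//|k IH] kp; have [ak ak1] := IH (ltnW kp); split=> //.
by rewrite rec // ak ak1 mulr0 subr0.
Qed.

(** For [l = 0] the recurrence advances by two. If [p] is even, it runs from 0 along the even
    positions up to the edge of weight 0. If [p] is odd, it goes twice round the cycle and returns
    with [2 a 0 = - 2 a 0]. *)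
Lemma cyclic_recurrence_inj : l = 0 -> a 0 = 0.
Proof.
move=> l0; have aE0 k : a k.+2 * w k.+2 = - (a k * w k.+1).
  by apply/eqP; rewrite -addr_eq0 addrC -aE l0 mul0r.
have even_a k : (k.*2 < p)%N -> a k.*2 = (-1) ^+ k * a 0.
  elim: k => [|k IH]; first by rewrite mul1r.
  rewrite doubleS => kp.
  have := aE0 k.*2; rewrite !w1 ?mulr1; try lia.
  by move=> ->; rewrite IH ?exprS ?mulN1r ?mulNr //; lia.
have odd_a k : (k.*2.+1 < p)%N -> a k.*2.+1 = (-1) ^+ k * a 1.
  elim: k => [|k IH]; first by rewrite mul1r.
  rewrite doubleS => kp.
  have := aE0 k.*2.+1; rewrite !w1 ?mulr1; try lia.
  by move=> ->; rewrite IH ?exprS ?mulN1r ?mulNr //; lia.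
have sign_inj k x : (-1) ^+ k * x = 0 :> F -> x = 0.
  by move=> /eqP; rewrite mulf_eq0 signr_eq0 => /eqP.
have := odd_double_half p; move: d_val; case: (odd p) => dv.
  rewrite add1n; case: p./2 => [|q] pE.
    (* Length 1: the single vertex is both neighbours of itself, so the loop counts twice. *)
    have wd k : w k = d.
      by elim: k => [//|k IH]; rewrite -add1n pE w_period.
    have ad k : a k = a 0.
      by elim: k => [//|k IH]; rewrite -[k.+1]add1n pE a_period.
    have := aE0 0; rewrite !wd !ad dv => /eqP; rewrite -addr_eq0 -mulrDr mulf_eq0.
    by rewrite -natrD pnatr_eq0 orbF => /eqP.
  have a1 : a 1 = (-1) ^+ q * d * a 0.
    have := aE0 q.+1.*2; rewrite pE -[p.+1]addn1 a_period w_period w_p w1 ?mulr1.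
      by move=> ->; rewrite even_a ?exprS; [ring | lia].
    lia.
  have := aE0 q.*2.+1; rewrite -doubleS pE a_p w_p w1 ?mulr1; last lia.
  rewrite odd_a; last lia.
  rewrite a1 !mulrA -exprD addnn -mul2n exprM sqrrN !expr1n mul1r dv => h.
  have : a 0 *+ 4 = 0.
    by have -> : a 0 *+ 4 = a 0 * 2 + 2 * a 0 by [ring]; rewrite h addNr.
  by move/eqP; rewrite mulrn_eq0 => /eqP.
rewrite add0n; case: p./2 => [|q] pE; first by lia.
have := aE0 q.*2; rewrite -doubleS pE w_p dv mulr0 w1 ?mulr1; last lia.
by rewrite even_a ?exprS; last lia; move/eqP; rewrite eq_sym oppr_eq0 => /eqP/sign_inj.
Qed.
End CyclicRecurrence.

(** * The symmetric matrix of a permutation cycle *)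

Section OrbitMatrix.
Variables (n : nat) (g : {perm 'I_n}) (j : 'I_n).

(** Weight of the edge entering [s] along the cycle. The value 2 breaks the reflection fixing [j],
    whose antisymmetric eigenvectors would vanish at [j]. *)
Definition orbit_weight (s : 'I_n) : nat :=
  if s == j then if odd #|porbit g j| then 2 else 0 else 1.

(* The cycle through [j]: the edge closing it is dropped if the cycle is even,
   which leaves a path starting at [j], and is given weight 2 if it is odd. *)
Definition orbit_mx : 'M[nat]_n := \matrix_(r, s) (if r \in porbit g j then
  (g r == s) * orbit_weight s + (g s == r) * orbit_weight r else 0)%N.

Lemma porbit_step r : (g r \in porbit g j) = (r \in porbit g j).
Proof. by rewrite -!eq_porbit_mem -[g r]/((g ^+ 1)%g r) porbit_perm. Qed.

Lemma orbit_mx_sym r s : orbit_mx r s = orbit_mx s r.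
Proof.
rewrite !mxE addnC; have [<-|_] := eqVneq (g s) r.
  by rewrite porbit_step.
have [<-|_] := eqVneq (g r) s; first by rewrite porbit_step.
by rewrite !mul0n !if_same.
Qed.

Lemma orbit_mx_neq0 r s : orbit_mx r s != 0%N -> g r = s \/ g s = r.
Proof.
rewrite mxE; case: ifP => // _.
have [|_] := eqVneq (g r) s; first by left.
by have [|_] := eqVneq (g s) r; [right | rewrite eqxx].
Qed.

Variable F : numClosedFieldType.
Let C : 'M[F]_n := map_mx (fun k : nat => k%:R) orbit_mx.
Let x k := iter k g j.
Let p := #|porbit g j|.

Let x_mem k : x k \in porbit g j.
Proof. by rewrite /x -permX mem_porbit. Qed.

Lemma orbit_mx_supported : supported (porbit g j) C.
Proof.
split; apply/matrixP => r s; rewrite ?coord_proj_mul ?mul_coord_proj.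
  by case: ifP => // rP; rewrite !mxE rP.
by case: ifP => // sP; rewrite mxE orbit_mx_sym mxE sP.
Qed.

Let p_gt0 : (0 < p)%N.
Proof. by rewrite card_gt0; apply/set0Pn; exists j; apply: porbit_id. Qed.

Let x_period k : x (p + k)%N = x k.
Proof. by rewrite addnC /x iterD iter_porbit. Qed.

Let x_neq k : (0 < k < p)%N -> x k != j.
Proof.
move=> /andP[k_gt0 kp]; have := uniq_traject_porbit g j.
rewrite -/p -(prednK p_gt0) /= => /andP[+ _]; apply: contraNneq => xk.
by apply/trajectP; exists k.-1; [lia | rewrite -iterSr prednK].
Qed.

Let mul_orbit_mx (v : 'rV[F]_n) k : (v *m C) 0 (x k.+1) =
  v 0 (x k) * (orbit_weight (x k.+1))%:R +
  v 0 (x k.+2) * (orbit_weight (x k.+2))%:R.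
Proof.
(* Predecessor and successor may coincide, so their contributions are summed separately. *)
rewrite mxE (eq_bigr (fun r => (r == x k)%:R * (v 0 (x k) * (orbit_weight (x k.+1))%:R)
  + (r == x k.+2)%:R * (v 0 (x k.+2) * (orbit_weight (x k.+2))%:R))).
  rewrite big_split /=; congr (_ + _).
    by rewrite (bigD1 (x k)) //= big1 ?eqxx ?mul1r ?addr0 // => i /negPf->; rewrite mul0r.
  by rewrite (bigD1 (x k.+2)) //= big1 ?eqxx ?mul1r ?addr0 // => i /negPf->; rewrite mul0r.
move=> r _; rewrite /C mxE orbit_mx_sym mxE x_mem natrD mulrDr addrC; congr (_ + _).
  rewrite -[x k.+1]/(g (x k)) (inj_eq perm_inj).
  by have [->|_] := eqVneq r (x k); rewrite ?mul1n ?mul0n ?mul1r ?mulr0 ?mul0r.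
rewrite -[g (x k.+1)]/(x k.+2) eq_sym.
by have [->|_] := eqVneq r (x k.+2); rewrite ?mul1n ?mul0n ?mul1r ?mulr0 ?mul0r.
Qed.

Let orbit_recurrence l (v : 'rV[F]_n) : v *m C = l *: v ->
  let a k := v 0 (x k) in
  (a 0 = 0 -> forall k, (k < p)%N -> a k = 0) /\ (l = 0 -> a 0 = 0).
Proof.
move=> vC a; pose w k : F := (orbit_weight (x k))%:R.
have ap k : a (p + k)%N = a k by rewrite /a x_period.
have wp k : w (p + k)%N = w k by rewrite /w x_period.
have w1 k : (0 < k < p)%N -> w k = 1.
  by move=> /x_neq xj; rewrite /w /orbit_weight (negPf xj).
have aE k : l * a k.+1 = a k * w k.+1 + a k.+2 * w k.+2.
  by rewrite /a /w -mul_orbit_mx vC mxE.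
have w0 : w 0 = if odd p then 2 else 0.
  by rewrite /w /orbit_weight eqxx; case: ifP.
split; first exact: (cyclic_recurrence_obs p_gt0 ap wp w0 w1 erefl aE).
exact: (cyclic_recurrence_inj p_gt0 ap wp w0 w1 erefl aE).
Qed.

Lemma orbit_mx_obs l (v : 'rV[F]_n) : v *m coord_proj (porbit g j) = v ->
  v *m C = l *: v -> v 0 j = 0 -> v = 0.
Proof.
move=> vP /orbit_recurrence[+ _] vj; move/(_ vj) => ak.
apply/rowP => r; rewrite -vP mul_coord_proj mxE; case: ifP => //.
rewrite porbit_traject => /trajectP[k kp ->]; exact: ak.
Qed.

Lemma orbit_mx_inj (v : 'rV[F]_n) : v *m coord_proj (porbit g j) = v ->
  v *m C = 0 -> v = 0.
Proof.
move=> vP vC; have {}vC : v *m C = 0 *: v by rewrite scale0r.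
have [_ /(_ erefl) vj] := orbit_recurrence vC.
exact: orbit_mx_obs vC vj.
Qed.
End OrbitMatrix.

(** * Growing the controllable set of states *)

Definition natmx (F : numClosedFieldType) n m (M : 'M[nat]_(n, m)) : 'M[F]_(n, m) :=
  map_mx (fun k => k%:R) M.

Lemma natmx_supported (F : numClosedFieldType) n (S : {set 'I_n}) (M : 'M[nat]_n) :
  (forall r s, M r s = M s r) -> (forall r s, r \notin S -> M r s = 0%N) ->
  supported S (natmx F M).
Proof.
move=> M_sym M0; split; apply/matrixP => r s;
  rewrite ?coord_proj_mul ?mul_coord_proj mxE; case: ifPn => // hS.
  by rewrite M0.
by rewrite M_sym M0.
Qed.

Section Growth.
Variables (F : numClosedFieldType) (n m : nat).
Variables (A : structured n n) (B : structured n m).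
Hypothesis A_sym : symmetrically_structured A.

(** Natural entries let the same matrices be read over [F], where the test is run, and over the
    reals. *)
Definition controllable_on (S : {set 'I_n}) :=
  exists (At : 'M[nat]_n) (Bt : 'M[nat]_(n, m)),
  [/\ (forall r s, At r s = At s r),
      (forall r s, At r s != 0%N -> A r s /\ r \in S),
      (forall r u, Bt r u != 0%N -> B r u /\ r \in S)
    & hautus S (natmx F At) (natmx F Bt)].

Lemma controllable_on_orbit (S : {set 'I_n}) (g : {perm 'I_n}) (j : 'I_n) :
  controllable_on S -> [disjoint S & porbit g j] ->
  (forall r, r \in porbit g j -> A r (g r)) ->
  (exists u, B j u) \/ (exists2 i, i \in S & A j i) ->
  controllable_on (S :|: porbit g j).
Proof.
move=> [At [Bt [At_sym AtS BtS hAB]]] dSP gP.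
have jP : j \in porbit g j := porbit_id g j.
have suppA : supported S (natmx F At).
  apply: natmx_supported => // r s; apply: contraNeq.
  by case/AtS.
have suppB : coord_proj S *m natmx F Bt = natmx F Bt.
  apply/matrixP => r u; rewrite coord_proj_mul mxE; case: ifPn => // rS.
  by have [->//|/BtS[_ rS']] := eqVneq (Bt r u) 0%N; rewrite rS' in rS.
have suppC := orbit_mx_supported g j F.
have C_inj := @orbit_mx_inj _ g j F.
have C_obs := @orbit_mx_obs _ g j F.
have orbitP r s : orbit_mx g j r s != 0%N -> A r s /\ r \in porbit g j.
  move=> rs; have rP : r \in porbit g j by move: rs; rewrite mxE; case: ifP.
  split=> //; move: (rs) => /orbit_mx_neq0[<-|sr]; first exact: gP.
  rewrite A_sym -sr; apply: gP; rewrite orbit_mx_sym in rs.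
  by move: rs; rewrite mxE; case: ifP.
case=> [[u Bju]|[i iS Aji]].
  have [c hc] := hautus_attach_input dSP jP suppA suppB hAB suppC C_inj C_obs u.
  exists (\matrix_(r, s) (At r s + c.+1 * orbit_mx g j r s)%N).
  exists (\matrix_(r, v) (Bt r v + ((r == j) && (v == u)))%N); split.
  - by move=> r s; rewrite mxE [RHS]mxE At_sym orbit_mx_sym.
  - move=> r s; rewrite mxE in_setU addn_eq0 negb_and muln_eq0 /=.
    by case/orP => [/AtS|/orbitP] [-> ->]; rewrite ?orbT.
  - move=> r v; rewrite mxE in_setU addn_eq0 negb_and.
    case/orP => [/BtS[-> ->]//|]; rewrite eqb0 negbK => /andP[/eqP-> /eqP->].
    by rewrite jP orbT.
  - move: hc; congr hautus; apply/matrixP => r s; rewrite !mxE natrD ?natrM //.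
case: (hautus_attach_state dSP jP suppA suppB hAB suppC C_inj C_obs iS).
move=> c [e hce].
exists (\matrix_(r, s) (At r s + c.+1 * orbit_mx g j r s +
   e.+1 * (((r == i) && (s == j)) + ((r == j) && (s == i))))%N), Bt; split.
- move=> r s; rewrite mxE [RHS]mxE At_sym orbit_mx_sym.
  by rewrite [(_ && _ + _)%N]addnC ![(s == _) && _]andbC.
- move=> r s; rewrite mxE in_setU 2!addn_eq0 2!muln_eq0 addn_eq0 /= !eqb0 !negb_and.
  case/orP => [/orP[/AtS|/orbitP] [-> ->]|]; rewrite ?orbT //.
  rewrite !negb_or !negbK.
  case/orP => /andP[/eqP-> /eqP->]; first by rewrite A_sym iS.
  by rewrite jP orbT.
- by move=> r u /BtS[-> rS]; rewrite in_setU rS.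
- move: hce; congr hautus; apply/matrixP => r s.
  by rewrite !mxE 2!natrD 2!natrM natrD.
Qed.

(** Induction on the number of states outside [S]: as [S] is invariant under [g], the whole orbit of
    the new state [j] lies outside [S] and is attached at once. *)
Lemma controllable_on_setT (g : {perm 'I_n}) (S : {set 'I_n}) :
  controllable_on S ->
  (forall x, x \notin S -> A x (g x)) -> (forall x, (g x \in S) = (x \in S)) ->
  (forall T : {set 'I_n}, T != setT -> exists2 j, j \notin T &
     (exists u, B j u) \/ (exists2 i, i \in T & A j i)) ->
  controllable_on setT.
Proof.
move=> hS hg gS hreach; have [k] := ubnP #|~: S|; elim: k S hS hg gS => // k IH.
move=> S hS hg gS lt_k; have [<-//|/hreach[j jS hj]] := eqVneq S setT.
have P_S x : x \in porbit g j -> x \notin S.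
  by move=> /porbitP[i ->]; rewrite permX; elim: i => //= i; rewrite gS.
have dSP : [disjoint S & porbit g j].
  by rewrite disjoint_sym disjoint_subset; apply/subsetP => x /P_S.
apply: (IH (S :|: porbit g j)).
- by apply: controllable_on_orbit => // r /P_S; apply: hg.
- by move=> x; rewrite in_setU negb_or => /andP[/hg].
- by move=> x; rewrite !in_setU gS porbit_step.
- rewrite -ltnS; apply: leq_trans lt_k; rewrite ltnS; apply: proper_card.
  rewrite setCU properE subsetIl /=.
  by apply/subsetPn; exists j; rewrite !inE ?jS // porbit_id andbF.
Qed.

(** * Stems and cycles of a matching *)

Section Matching.
Variable f : 'I_n -> vertex n m.
Hypothesis f_inj : injective f.
Hypothesis f_edge : forall x, system_edge A B (f x) (inl x).

(** Inputs are made fixed points so that [f], which goes upstream, can be iterated. *)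
Let step (v : vertex n m) : vertex n m := if v is inl x then f x else v.

Definition stems : {set 'I_n} :=
  [set x | [exists u, fconnect step (inl x) (inr u)]].

Lemma stemsP x : reflect (exists k u, iter k step (inl x) = inr u) (x \in stems).
Proof.
rewrite inE; apply: (iffP existsP) => [[u /iter_findex xu]|[k [u xu]]].
  by exists (findex step (inl x) (inr u)), u.
by exists u; rewrite -xu fconnect_iter.
Qed.

Lemma stems_input x u : f x = inr u -> x \in stems.
Proof. by move=> fx; apply/stemsP; exists 1, u; rewrite /= fx. Qed.

Lemma stems_step x y : f x = inl y -> (y \in stems) = (x \in stems).
Proof.
move=> fx; apply/stemsP/stemsP => [[k [u yu]]|[[|k] [u]]] //.
  by exists k.+1, u; rewrite iterSr /= fx.
by rewrite iterSr /= fx => yu; exists k, u.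
Qed.

(** Induction on the distance to the input. As [f] is injective, column [f x] of the eigenvector
    equation involves only [x], [f x] and [f (f x)], and the eigenvector already vanishes at states
    nearer to the input. If [f x] is an input, its column of the input matrix gives the claim. *)
Lemma controllable_on_stems : controllable_on stems.
Proof.
exists (\matrix_(r, s) (if r \in stems then
  (f r == inl s) + (f s == inl r) else 0)%N).
exists (\matrix_(r, u) (f r == inr u : nat)); split.
- move=> r s; rewrite !mxE addnC.
  have [fs|_] := eqVneq (f s) (inl r); first by rewrite (stems_step fs).
  have [fr|_] := eqVneq (f r) (inl s); first by rewrite (stems_step fr).
  by rewrite !if_same.
- move=> r s; rewrite mxE; case: ifP => // _; rewrite addn_eq0 negb_and !eqb0 !negbK.
  by case/orP => /eqP fr; [have := f_edge r | have := f_edge s]; rewrite fr // A_sym.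
- move=> r u; rewrite mxE eqb0 negbK => /eqP fr; rewrite (stems_input fr).
  by have := f_edge r; rewrite fr.
move=> l v vS vA vB.
suff v0 k x u : iter k step (inl x) = inr u -> v 0 x = 0.
  apply/rowP => x; rewrite -vS mul_coord_proj mxE.
  by case: ifP => // /stemsP[k [u]]; apply: v0.
elim/ltn_ind: k x u => -[//|k] IH x u; rewrite iterSr /=.
case fx: (f x) => [y|u'] yu; last first.
  have /rowP/(_ u') := vB; rewrite mxE (bigD1 x) //= big1 => [|r rx].
    by rewrite !mxE fx eqxx mulr1 addr0.
  by rewrite !mxE -fx (inj_eq f_inj) (negPf rx) mulr0.
have vy : v 0 y = 0 by apply: IH yu.
have xS : x \in stems by rewrite -(stems_step fx); apply/stemsP; exists k, u.
have /rowP/(_ y) := vA; rewrite [RHS]mxE vy mulr0 mxE (bigD1 x) //= big1 => [|r rx].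
  rewrite !mxE xS fx eqxx addr0; case: eqP => [fy|_]; last by rewrite mulr1.
  by move/eqP; rewrite mulf_eq0 pnatr_eq0 orbF => /eqP.
rewrite !mxE -fx (inj_eq f_inj) (negPf rx); case: ifP => _; last by rewrite mulr0.
case: eqP => [fy|_]; last by rewrite mulr0.
case: k IH yu => [//|k] IH; rewrite iterSr /= fy => ru.
by rewrite (IH k _ _ _ ru) ?mul0r // ltnW.
Qed.

(** Being the identity on the stems makes this a permutation of all states. The final [x] is a
    default that is never reached: a state sent to an input is in [stems]. *)
Definition stems_complement_fun (x : 'I_n) : 'I_n :=
  if x \in stems then x else if f x is inl y then y else x.

Lemma stems_complement_fun_stems x : (stems_complement_fun x \in stems) = (x \in stems).
Proof.
rewrite /stems_complement_fun; case: ifP => // xS.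
by case fx: (f x) => [y|u]; rewrite ?(stems_step fx).
Qed.

Lemma stems_complement_funE x : x \notin stems -> f x = inl (stems_complement_fun x).
Proof.
move=> xS; rewrite /stems_complement_fun (negPf xS); case fx: (f x) => [//|u].
by rewrite (stems_input fx) in xS.
Qed.

Lemma stems_complement_fun_inj : injective stems_complement_fun.
Proof.
move=> x y xy; have := congr1 [in stems] xy.
rewrite /= !stems_complement_fun_stems.
have [yS xS|yS xS] := boolP (y \in stems).
  by move: xy; rewrite /stems_complement_fun xS yS.
have /f_inj[//] : f x = f y.
by rewrite !stems_complement_funE ?xS ?yS // xy.
Qed.

Lemma controllable_on_matching :
  (forall T : {set 'I_n}, T != setT -> exists2 j, j \notin T &
     (exists u, B j u) \/ (exists2 i, i \in T & A j i)) ->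
  controllable_on setT.
Proof.
apply: (@controllable_on_setT (perm stems_complement_fun_inj) stems).
- exact: controllable_on_stems.
- move=> x xS; rewrite permE; have := f_edge x.
  by rewrite (stems_complement_funE xS).
- by move=> x; rewrite permE stems_complement_fun_stems.
Qed.
End Matching.
End Growth.

(** * Hall's theorem *)

(** Rado's argument: while some [N x] has two elements, one of them can be deleted without
    destroying Hall's condition; once all are singletons, the condition makes them distinct. *)
Lemma hall_matching (X Y : finType) (N : X -> {set Y}) :
  (forall S : {set X}, (#|S| <= #|\bigcup_(x in S) N x|)%N) ->
  exists2 f : X -> Y, injective f & forall x, f x \in N x.
Proof.
have [k] := ubnP (\sum_x #|N x|)%N; elim: k N => // k IH N lt_k hallN.
have [[x] | small] := EM (exists x, (1 < #|N x|)%N); last first.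
  have /fin_all_exists[f fE] x : exists y, N x = [set y].
    apply/cards1P; rewrite eqn_leq; apply/andP; split.
      by rewrite leqNgt; apply/negP => Nx; apply: small; exists x.
    by have := hallN [set x]; rewrite cards1 big_set1.
  exists f => [x1 x2 fx|x]; last by rewrite fE set11.
  apply/eqP; apply: contraT => x12; have := hallN [set x1; x2].
  by rewrite cards2 x12 bigcup_setU !big_set1 !fE fx setUid cards1.
move=> /card_gt1P[y1 [y2 [y1x y2x y12]]].
pose M y z := if z == x then N x :\ y else N z.
have [[y yx hallM] | no_hall] := EM (exists2 y, y \in N x &
    forall S : {set X}, (#|S| <= #|\bigcup_(z in S) M y z|)%N).
  have [|f f_inj fM] := IH (M y) _ hallM.
    rewrite -ltnS; apply: leq_trans lt_k; rewrite ltnS.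
    rewrite (bigD1 x) //= [ltnRHS](bigD1 x) //= /M eqxx [#|N x|](cardsD1 y) yx.
    rewrite add1n addSn ltnS leq_add2l; apply: leq_sum => z /negPf zx.
    by rewrite zx.
  exists f => // z; have := fM z; rewrite /M; case: eqP => // ->.
  by rewrite in_setD1 => /andP[].
have bad y : y \in N x -> exists S : {set X},
    x \in S /\ (#|\bigcup_(z in S) M y z| < #|S|)%N.
  move=> yx; apply: contrapT => noS; apply: no_hall; exists y => // S.
  rewrite leqNgt; apply/negP => hS; apply: noS; exists S; split=> //.
  apply: contraTT hS => xS; rewrite -leqNgt (eq_bigr N) // => z zS.
  by rewrite /M; case: eqP zS xS => // -> ->.
have [S1 [xS1 hS1]] := bad y1 y1x.
have [S2 [xS2 hS2]] := bad y2 y2x.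
set T1 := \bigcup_(z in S1) _ in hS1; set T2 := \bigcup_(z in S2) _ in hS2.
(* Submodularity of the neighbourhood function. *)
have subU : \bigcup_(z in S1 :|: S2) N z \subset T1 :|: T2.
  apply/bigcupsP => z zS; apply/subsetP => y yz; rewrite in_setU.
  have [zx|zx] := eqVneq z x.
    have [yy1|yy1] := eqVneq y y1.
      apply/orP; right; apply/bigcupP; exists x => //.
      by rewrite /M eqxx in_setD1 yy1 y12.
    apply/orP; left; apply/bigcupP; exists x => //.
    by rewrite /M eqxx in_setD1 yy1 -zx.
  move: zS; rewrite in_setU => /orP[zS|zS]; apply/orP; [left|right];
    by apply/bigcupP; exists z => //; rewrite /M (negPf zx).
have subI : \bigcup_(z in (S1 :&: S2) :\ x) N z \subset T1 :&: T2.
  apply/bigcupsP => z; rewrite in_setD1 in_setI => /and3P[zx z1 z2].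
  by apply/subsetP => y yz; rewrite in_setI; apply/andP; split; apply/bigcupP;
    exists z => //; rewrite /M (negPf zx).
(* Hall's condition on the union and on the intersection without [x] gives
   [#|S1| + #|S2| - 1 <= #|T1| + #|T2|], but the right side is at most [#|S1| + #|S2| - 2]. *)
have := leq_trans (hallN _) (subset_leq_card subU).
have := leq_trans (hallN _) (subset_leq_card subI).
have := cardsUI T1 T2; have := cardsUI S1 S2.
have := cardsD1 x (S1 :&: S2); rewrite in_setI xS1 xS2 /=.
by lia.
Qed.

(** * From controllability to the graph conditions and back *)

Section Controllability.
Variables (R : realType) (n m : nat).

Lemma controllable_krylov (At : 'M[R]_n) (Bt : 'M[R]_(n, m)) :
  \rank (controllability_matrix At Bt) = n <->
  forall v : 'rV[R]_n, (forall k, (k < n)%N -> v *m (At ^+ k *m Bt) = 0) -> v = 0.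
Proof.
split=> [/eqP rkQ v hv | inj].
  apply/eqP; rewrite -(mulmx_free_eq0 v rkQ) mul_mxrow; apply/eqP.
  by rewrite -[RHS]mxrow0; apply: eq_mxrow => k; apply: hv.
apply/eqP/inj_row_free => v; rewrite mul_mxrow => vQ; apply: inj => k kn.
have /eq_mxrowP/(_ (Ordinal kn)) // : \mxrow_(k < n) (v *m (At ^+ k *m Bt)) =
  \mxrow_(k < n) (0 : 'M[R]_(1, m)) by rewrite vQ mxrow0.
Qed.

Variables (A : structured n n) (B : structured n m).

(** In-neighbours of an unreachable state are unreachable, so the row is a combination of rows that
    vanish by induction on [k]. *)
Lemma unreachable_krylov (At : 'M[R]_n) (Bt : 'M[R]_(n, m)) k i u :
  realization A At -> realization B Bt -> ~ input_reachable A B (inl i) ->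
  (At ^+ k *m Bt) i u = 0.
Proof.
move=> hA hB; elim: k i => [|k IH] i hi.
  rewrite mul1mx; apply: hB; apply/negP => Biu; apply: hi.
  by exists (inr u); [apply: imset_f | apply: connect1].
rewrite exprS -mulmxA mxE big1 // => j _.
have [Aij|/negPf/hA ->] := boolP (A i j); last by rewrite mul0r.
rewrite IH ?mulr0 // => -[v vU vj]; apply: hi; exists v => //.
by apply: connect_trans vj _; apply: connect1.
Qed.

Lemma controllable_reachable x : structurally_controllable R A B ->
  x \in state_vertices n m -> input_reachable A B x.
Proof.
move=> [At [Bt [[hA _] hB /controllable_krylov inj]]] /imsetP[i _ ->].
apply: contrapT => hi; have : (delta_mx 0 i : 'rV[R]_n) = 0.
  apply: inj => k _; rewrite -rowE; apply/rowP => u.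
  by rewrite mxE unreachable_krylov // mxE.
by move/rowP/(_ i); rewrite !mxE !eqxx => /eqP; rewrite oner_eq0.
Qed.

Lemma controllable_neighbours (S : {set vertex n m}) :
  structurally_controllable R A B -> S \subset state_vertices n m ->
  (#|S| <= #|in_neighbours A B S|)%N.
Proof.
move=> [At [Bt [[hA _] hB /controllable_krylov inj]]] S_state.
pose T := [set i | inl i \in S].
pose N1 := [set i | inl i \in in_neighbours A B S].
pose N2 := [set u | inr u \in in_neighbours A B S].
have cardS : #|S| = #|T|.
  rewrite -(card_imset (mem T) (@inl_inj 'I_n 'I_m)); apply: eq_card => x.
  apply/idP/imsetP => [xS|[i + ->]]; last by rewrite inE.
  by have /imsetP[i _ xi] := subsetP S_state x xS; exists i; rewrite // inE -xi.
have cardN : (#|N1| + #|N2| <= #|in_neighbours A B S|)%N.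
  rewrite -(card_imset (mem N1) (@inl_inj 'I_n 'I_m)).
  rewrite -(card_imset (mem N2) (@inr_inj 'I_n 'I_m)).
  rewrite -cardsUI [X in (_ + X)%N](_ : _ = 0%N) ?addn0.
    apply: subset_leq_card; apply/subsetP => x; rewrite in_setU.
    by case/orP => /imsetP[i + ->]; rewrite [in X in X -> _]inE.
  apply/eqP; rewrite cards_eq0 -subset0; apply/subsetP => x; rewrite in_setI.
  by case/andP => /imsetP[i _ ->] /imsetP[].
(* Every Krylov block starts on the left with [At] or is [Bt] itself, so a vector killing both kills
   them all. *)
have rfAB : row_free (row_mx At Bt).
  apply: inj_row_free => v; rewrite mul_mx_row => /eqP; rewrite row_mx_eq0.
  move=> /andP[/eqP vA /eqP vB]; apply: inj => -[_|k _]; first by rewrite mul1mx.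
  by rewrite exprS -mulmxA mulmxA vA mul0mx.
have rank_le p (M : 'M[R]_(n, p)) (N : {set 'I_p}) :
    (forall i j, i \in T -> j \notin N -> M i j = 0) ->
    (\rank (coord_proj T *m M) <= #|N|)%N.
  move=> M0; rewrite -(rank_coord_proj R N).
  have <- : coord_proj T *m M *m coord_proj N = coord_proj T *m M.
    apply/matrixP => i j; rewrite mul_coord_proj !coord_proj_mul.
    by case: ifPn => // jN; case: ifP => // iT; rewrite M0.
  exact: mxrankM_maxr.
(* The rows in [T] of the full-row-rank matrix have rank [#|T|]; their state columns contribute at
   most [#|N1|] and their input columns at most [#|N2|]. *)
apply: leq_trans cardN; rewrite cardS -(rank_coord_proj R T) -(mxrankMfree _ rfAB).
rewrite mul_mx_row -[row_mx _ _]addr0.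
have -> : row_mx (coord_proj T *m At) (coord_proj T *m Bt) =
    row_mx (coord_proj T *m At) 0 + row_mx 0 (coord_proj T *m Bt).
  by rewrite add_row_mx addr0 add0r.
rewrite addr0; apply: leq_trans (mxrank_add _ _) _.
rewrite rank_row_mx0 rank_row_0mx; apply: leq_add; apply: rank_le => i j.
  rewrite !inE => iT; apply: contraNeq => Mij; apply/existsP.
  by exists (inl i); rewrite iT /=; apply: contraNT Mij => /negPf/hA ->.
rewrite !inE => iT; apply: contraNeq => Mij; apply/existsP.
by exists (inl i); rewrite iT /=; apply: contraNT Mij => /negPf/hB ->.
Qed.

(** A real vector killed by the Krylov blocks stays so over [F], where the Hautus test makes it 0,
    and [f] is injective. *)
Lemma structurally_controllable_of (F : numClosedFieldType) (f : {rmorphism R -> F}) :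
  controllable_on F A B setT -> structurally_controllable R A B.
Proof.
move=> [At [Bt [At_sym AtA BtB hAB]]].
pose natR p (M : 'M[nat]_(n, p)) : 'M[R]_(n, p) := map_mx (fun k => k%:R) M.
have natRF p (M : 'M[nat]_(n, p)) : map_mx f (natR p M) = natmx F M.
  by apply/matrixP => i j; rewrite !mxE rmorph_nat.
exists (natR n At), (natR m Bt); split.
- split=> [i j Aij|i j]; rewrite !mxE; last by rewrite At_sym.
  by have [->//|/AtA[]] := eqVneq (At i j) 0%N; rewrite Aij.
- move=> i u Biu; rewrite mxE.
  by have [->//|/BtB[]] := eqVneq (Bt i u) 0%N; rewrite Biu.
apply/controllable_krylov => v hv.
apply/eqP; rewrite -(map_mx_eq0 f); apply/eqP.
apply: (hautus_krylov _ hAB) => [||k kn]; rewrite ?coord_projT ?mulmx1 //.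
rewrite -!natRF; have -> : map_mx f (natR n At) ^+ k = map_mx f (natR n At ^+ k).
  elim: k {kn} => [|k IH]; first by rewrite !expr0 map_mx1.
  by rewrite !exprS IH [RHS]map_mxM.
by rewrite -!map_mxM hv // map_mx0.
Qed.

Lemma reachable_boundary (T : {set 'I_n}) :
  (forall x, x \in state_vertices n m -> input_reachable A B x) -> T != setT ->
  exists2 j, j \notin T & (exists u, B j u) \/ (exists2 i, i \in T & A j i).
Proof.
move=> reach; rewrite -subTset => /subsetPn[x _ xT].
apply: contrapT => no_j.
have [_ /imsetP[u _ ->] /connectP[p]] := reach (inl x) (imset_f _ isT).
(* If no such [j] exists, a path from an input never leaves [T], inputs being counted as inside. *)
suff in_T v : (if v is inl i then i \in T else true) -> path (system_edge A B) v p ->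
    inl x = last v p -> x \in T.
  by move=> /in_T h /h; move/(_ isT); apply/negP.
elim: p v => [|w p IH] v vT /=; first by move=> _ xv; rewrite -xv in vT.
move=> /andP[vw /IH]; apply; case: w vw {p IH} => [i|u']; last by case: v vT.
move=> vi; apply: contrapT => /negP iT; apply: no_j; exists i => //.
by case: v vT vi => [k kT Aik|u' _ Biu]; [right; exists k | left; exists u'].
Qed.

Lemma neighbours_matching :
  (forall S : {set vertex n m}, S \subset state_vertices n m ->
     (#|S| <= #|in_neighbours A B S|)%N) ->
  exists2 f : 'I_n -> vertex n m, injective f &
    forall x, system_edge A B (f x) (inl x).
Proof.
move=> hallS.
have [T|f f_inj fN] := @hall_matching _ _
    (fun x : 'I_n => [set v | system_edge A B v (inl x)]).
  rewrite -(card_imset (mem T) (@inl_inj 'I_n 'I_m)).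
  apply: leq_trans (hallS _ _) _; first by apply/subsetP => _ /imsetP[x _ ->]; apply: imset_f.
  apply: subset_leq_card; apply/subsetP => v; rewrite inE.
  move=> /existsP[_ /andP[/imsetP[x xT ->] vx]].
  by apply/bigcupP; exists x; rewrite // inE.
by exists f => // x; have := fN x; rewrite inE.
Qed.

End Controllability.

Local Close Scope ring_scope.

Theorem theorem1 (R : realType) (n m : nat)
    (A : structured n n) (B : structured n m)
    (hA : symmetrically_structured A) :
  structurally_controllable R A B <->
  (forall x : vertex n m, x \in state_vertices n m -> input_reachable A B x) /\
  (forall S : {set vertex n m}, S \subset state_vertices n m ->
     #|S| <= #|in_neighbours A B S|).
Proof.
split=> [AB|[reach /neighbours_matching[f f_inj f_edge]]].
  split=> [x|S]; first exact: (controllable_reachable AB).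
  exact: (controllable_neighbours AB).
(* The algebraically closed extension is [R[i]]. *)
apply: (structurally_controllable_of (real_complex R)).
apply: (controllable_on_matching _ hA f_inj f_edge) => T.
exact: reachable_boundary.
Qed.
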